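(* Let $n\in\mathbb{N}$ and $\varepsilon>0$ be given. If $n\geqslant 2$ and $\varepsilon<\frac{1}{3600\,n^{11}}$, then every compact unitary group $\mathcal{G}\subseteq M_n(\mathbb{C})$ with a weak $\varepsilon$-approximate fixed point is reducible.
   Context: A unitary group $\mathcal{G}\subseteq M_n(\mathbb{C})$ is a group of unitary $n\times n$ complex matrices. $\mathbb{C}^n$ carries the standard inner product and $\|\cdot\|$ is the Euclidean norm. For $0<\varepsilon<1$, a vector $\xi\in\mathbb{C}^n$ with $\|\xi\|=1$ is a weak $\varepsilon$-approximate fixed point of $\mathcal{G}$ if $|\langle G\xi,\xi\rangle|\geqslant 1-\varepsilon$ for all $G\in\mathcal{G}$. $\mathcal{G}$ is reducible if there is a subspace of $\mathbb{C}^n$, different from $\{0\}$ and $\mathbb{C}^n$, that is invariant under every $G\in\mathcal{G}$. *)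

(* Defs.v *)
From HB Require Import structures.
From mathcomp Require Import all_boot all_order all_algebra.
From mathcomp Require Import complex.
From mathcomp Require Import boolp classical_sets reals topology normedtype.

Set Implicit Arguments.
Unset Strict Implicit.
Unset Printing Implicit Defensive.

Import Order.TTheory GRing.Theory Num.Theory.
Import numFieldNormedType.Exports.

Local Open Scope ring_scope.
Local Open Scope complex_scope.

Section UnitaryGroups.
Variables (R : realType) (n : nat).
Implicit Types (GG : set 'M[R[i]]_n) (A B : 'M[R[i]]_n).
Implicit Types (u v xi : 'cV[R[i]]_n) (V : {vspace 'cV[R[i]]_n}).

(* [dotmx] is linear in its first argument and conjugate-linear in its second,
   but it takes row vectors, whereas matrices act here on columns. *)
Definition inner u v : R[i] := dotmx u^T v^T.

Definition euclidean_norm u : R[i] := sqrtC (inner u u).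

Record unitary_group GG : Prop := UnitaryGroup {
  unitary_group_unitary : forall A, GG A -> A \is unitarymx;
  unitary_group1 : GG 1%:M;
  unitary_groupM : forall A B, GG A -> GG B -> GG (A *m B);
  unitary_groupV : forall A, GG A -> GG (invmx A)
}.

(* The topology is inferred on [R[i]^o], not on [R[i]]: on the former it is
   the one given by the modulus, and matrices carry the entrywise topology. *)
Definition compact_mx GG : Prop := compact (GG : set 'M[R[i]^o]_n).

(* The order of [R[i]] compares real parts of numbers with equal imaginary
   parts; both sides of the inequality are real. *)
Definition weak_approx_fixed_point (eps : R) GG xi : Prop :=
  euclidean_norm xi = 1 /\
  forall A, GG A -> (1 - eps)%:C <= `|inner (A *m xi) xi|.

Definition invariant_subspace A V : Prop := {in V, forall v, A *m v \in V}.

Definition reducible GG : Prop :=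
  exists V, [/\ V != 0%VS, V != fullv & forall A, GG A -> invariant_subspace A V].

End UnitaryGroups.

(* Main.v *)
Require Import Defs.
From mathcomp Require Import all_boot all_order all_algebra.
From mathcomp Require Import complex.
From mathcomp Require Import boolp classical_sets reals topology normedtype.
From mathcomp Require Import derive ring lra.

(** Averaging the rank-one projection [P] onto the line of [xi] over the
    conjugation action of the group gives a matrix [X] that commutes with the
    group.  If the group were irreducible, Schur's lemma would make [X] a scalar
    matrix, and since the trace stays equal to 1 the scalar would be [1 / n].
    On the other hand [<X xi, xi>] is the average of [|<G xi, xi>|^2], which is
    at least [(1 - eps)^2]; as [1 / n <= 1 / 2 < (1 - eps)^2], this is absurd.

    Instead of an integral over the group, the average is obtained as a point
    of least norm.  The conjugates of [P] all lie in the closed convex set [K]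
    of matrices [X] such that [Re (tr X) <= 1] and
    [Re <X (H xi), H xi> >= (1 - eps)^2] for all [H] in the group.  The group
    acts on [K] by conjugation, and this preserves the Frobenius norm, so the
    unique point of least Frobenius norm of [K] is fixed
    ([conjugation_fixed_point]).  The two families of inequalities defining [K]
    suffice to conclude: a scalar matrix [l] in [K] satisfies
    [n * Re l <= 1] and [Re l >= (1 - eps)^2].  Schur's lemma is
    [commutant_scalar_or_reducible]. *)

Set Implicit Arguments.
Unset Strict Implicit.
Unset Printing Implicit Defensive.

Import Order.TTheory GRing.Theory Num.Theory.
Import numFieldNormedType.Exports.

Local Open Scope ring_scope.
Local Open Scope complex_scope.
Local Open Scope classical_set_scope.
Local Open Scope sesquilinear_scope.

(** * The Frobenius norm *)

Definition sqr_frobenius (R : realType) n (X : 'M[R[i]]_n) : R :=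
  \sum_i \sum_j (complex.Re (X i j) ^+ 2 + complex.Im (X i j) ^+ 2).

Lemma sqr_frobeniusE (R : realType) n (X : 'M[R[i]]_n) :
  (sqr_frobenius X)%:C = \tr (X *m X^t* ).
Proof.
rewrite /sqr_frobenius rmorph_sum; apply: eq_bigr => i _.
rewrite rmorph_sum mxE; apply: eq_bigr => j _ /=.
by rewrite !mxE add_Re2_Im2 normCK.
Qed.

Lemma sqr_frobenius_parallelogram (R : realType) n (X Y : 'M[R[i]]_n) :
  sqr_frobenius (X - Y) + 4 * sqr_frobenius ((2^-1)%:C *: (X + Y)) =
  2 * sqr_frobenius X + 2 * sqr_frobenius Y.
Proof.
rewrite /sqr_frobenius !mulr_sumr -!big_split; apply: eq_bigr => i _ /=.
rewrite !mulr_sumr -!big_split; apply: eq_bigr => j _ /=.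
rewrite !mxE; case: (X i j) => a b; case: (Y i j) => c d; simpc => /=.
by field; exact: isT.
Qed.

Lemma sqr_frobenius_le0 (R : realType) n (X : 'M[R[i]]_n) :
  sqr_frobenius X <= 0 -> X = 0.
Proof.
have s0 (z : R[i]) : 0 <= complex.Re z ^+ 2 + complex.Im z ^+ 2.
  by rewrite addr_ge0 ?sqr_ge0.
have r0 i : 0 <= \sum_j (complex.Re (X i j) ^+ 2 + complex.Im (X i j) ^+ 2).
  exact: sumr_ge0.
move=> X0; apply/matrixP => i j; rewrite mxE.
have: sqr_frobenius X == 0 by rewrite eq_le X0 sumr_ge0.
rewrite psumr_eq0 // => /allP/(_ i); rewrite mem_index_enum => /(_ isT) /=.
rewrite psumr_eq0 // => /allP/(_ j); rewrite mem_index_enum => /(_ isT) /=.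
rewrite paddr_eq0 ?sqr_ge0 // !sqrf_eq0 => /andP[/eqP a /eqP b].
by apply/eqP; rewrite eq_complex a b !eqxx.
Qed.

Lemma sqr_frobenius_unitary_conj (R : realType) n (G X : 'M[R[i]]_n) :
  G \is unitarymx -> sqr_frobenius (G *m X *m G^t* ) = sqr_frobenius X.
Proof.
move=> uG; apply: complexI; rewrite !sqr_frobeniusE.
rewrite !trmx_mul !map_mxM /= -!map_trmx trmxK -map_mx_comp.
have -> : map_mx (Num.conj \o Num.conj) G = G.
  by apply/matrixP => i j; rewrite mxE; exact: conjCK.
rewrite !map_trmx !mulmxA (mulmxKtV (G *m X) uG erefl).
rewrite mxtrace_mulC !mulmxA -(invmx_unitary uG) mulVmx ?mul1mx //.
exact: unitarymx_unit.
Qed.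

(** * Points of least norm in closed convex sets of matrices *)

(** Real half-spaces of complex matrices are indexed by a bound [a] and a
    matrix [B], through the trace pairing: conjugating [X] amounts to
    conjugating [B] the other way round. *)
Definition half_space_meet (R : realType) n (hs : R -> 'M[R[i]]_n -> Prop) :
    set 'M[R[i]]_n :=
  [set X | forall a B, hs a B -> a <= complex.Re (\tr (X *m B))].

Definition realify (R : realType) n (X : 'M[R[i]]_n) :
    'rV[R]_(n * n + n * n) :=
  row_mx (mxvec (map_mx (@complex.Re R) X)) (mxvec (map_mx (@complex.Im R) X)).

Definition complexify (R : realType) n (v : 'rV[R]_(n * n + n * n)) :
    'M[R[i]]_n :=
  \matrix_(i, j) (v 0 (lshift _ (mxvec_index i j)) +i*
                  v 0 (rshift _ (mxvec_index i j))).

Lemma realifyK (R : realType) n : cancel (@realify R n) (@complexify R n).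
Proof.
move=> X; apply/matrixP => i j; rewrite mxE row_mxEl row_mxEr !mxvecE !mxE.
by case: (X i j).
Qed.

Lemma sqr_frobenius_complexify (R : realType) n (v : 'rV[R]_(n * n + n * n)) :
  sqr_frobenius (complexify v) = \sum_k v 0 k ^+ 2.
Proof.
rewrite big_split_ord /= !(reindex _ (curry_mxvec_bij n n)) /=.
rewrite /sqr_frobenius pair_bigA -big_split; apply: eq_bigr => -[i j] _ /=.
by rewrite mxE.
Qed.

Lemma continuous_Re_mxtrace (R : realType) n (B : 'M[R[i]]_n) :
  continuous ((fun v => complex.Re (\tr (complexify v *m B)))
              : 'rV[R]_(n * n + n * n) -> R).
Proof.
have -> : (fun v => complex.Re (\tr (complexify v *m B))) =
  (fun v : 'rV[R]_(n * n + n * n) => \sum_i \sum_j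
     (v 0 (lshift _ (mxvec_index i j)) * complex.Re (B j i)
     - v 0 (rshift _ (mxvec_index i j)) * complex.Im (B j i))).
  apply/funext => v; rewrite /mxtrace.
  rewrite (raddf_sum (@complex.Re R : Rcomplex R -> R)).
  apply: eq_bigr => i _; rewrite mxE.
  rewrite (raddf_sum (@complex.Re R : Rcomplex R -> R)).
  by apply: eq_bigr => j _; rewrite mxE; case: (B j i).
apply: (continuous_big (@add_continuous R)) => i _.
apply: (continuous_big (@add_continuous R)) => j _ v.
have cc (k : 'I_(n * n + n * n)) (c : R) : w 0 k * c @[w --> v] --> v 0 k * c.
  by apply: cvgMr_tmp; exact: coord_continuous.
exact: (cvgB (cc _ _) (cc _ _)).
Qed.

Lemma closed_half_space_meet (R : realType) n (hs : R -> 'M[R[i]]_n -> Prop) :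
  closed (@complexify R n @^-1` half_space_meet hs).
Proof.
have -> : @complexify R n @^-1` half_space_meet hs =
  \bigcap_(p in [set p | hs p.1 p.2])
    ((fun v => complex.Re (\tr (complexify v *m p.2))) @^-1`
     [set r | p.1 <= r]).
  apply/seteqP; split=> v /= Kv; first by move=> [a B] /=; exact: Kv.
  by move=> a B hB; exact: (Kv (a, B)).
apply: closed_bigI => -[a B] /= _.
apply: preimage_closed; last exact: closed_ge.
by move=> v _; exact: continuous_Re_mxtrace.
Qed.

(** The points of [K] that are no longer than a chosen [x0] in [K] form a
    compact set, on which the continuous squared norm attains its minimum. *)
Lemma least_sum_sqr (R : realType) N (K : set 'rV[R]_N) :
  closed K -> K !=set0 ->
  exists2 x, K x & forall y, K y -> \sum_k x 0 k ^+ 2 <= \sum_k y 0 k ^+ 2.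
Proof.
move=> cK [x0 Kx0].
pose q (x : 'rV[R]_N) := \sum_k x 0 k ^+ 2.
have q0 x : 0 <= q x by apply: sumr_ge0 => k _; exact: sqr_ge0.
have cq : continuous (q : 'rV[R]_N -> R).
  apply: (continuous_big (@add_continuous R)) => k _ x.
  have ck : w 0 k @[w --> x] --> x 0 k by exact: coord_continuous.
  exact: (cvgM ck ck).
pose A := K `&` (q @^-1` [set r | r <= q x0]).
have clA : closed A.
  apply: closedI => //; apply: preimage_closed; last exact: closed_le.
  by move=> v _; exact: cq.
have bA : bounded_set A.
  (* From [t ^+ 2 <= q x0] one gets [t <= q x0 + 1]. *)
  exists (q x0 + 1); split; first exact: num_real.
  move=> M ltM x [_ /= qx].
  rewrite [`|x|]mx_normrE; apply/bigmax_leP; split=> [|[i j] _ /=].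
    by have := q0 x0; lra.
  apply: le_trans (ltW ltM); rewrite ord1.
  have : `|x 0 j| ^+ 2 <= q x0.
    apply: le_trans qx; rewrite /q (bigD1 j) //= real_normK ?num_real // lerDl.
    by apply: sumr_ge0 => k _; exact: sqr_ge0.
  have := normr_ge0 (x 0 j); nra.
have A0 : A !=set0 by exists x0; split => //=.
have [c cA cmin] := @EVT_min_rV R N q A A0 (bounded_closed_compact bA clA)
   (continuous_subspaceT cq).
move: cA; rewrite inE => -[Kc qc]; exists c => // y Ky.
have [qy|/ltW qy] := leP (q y) (q x0); last exact: le_trans qy.
by apply: cmin; rewrite inE.
Qed.

(** Uniqueness is strict convexity of the Euclidean norm: by the parallelogram
    identity, the midpoint of two distinct points of least norm would be
    strictly shorter. *)
Lemma unique_least_sqr_frobenius (R : realType) n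
    (hs : R -> 'M[R[i]]_n -> Prop) :
  half_space_meet hs !=set0 ->
  exists2 X, half_space_meet hs X &
    forall Y, half_space_meet hs Y ->
      sqr_frobenius Y <= sqr_frobenius X -> Y = X.
Proof.
case=> X0 KX0.
have [||v Kv vmin] := @least_sum_sqr R _ (@complexify R n @^-1` half_space_meet hs).
- exact: closed_half_space_meet.
- by exists (realify X0); rewrite /= realifyK.
exists (complexify v) => // Y KY leYX; set X := complexify v in Kv leYX *.
have Xmin Z : half_space_meet hs Z -> sqr_frobenius X <= sqr_frobenius Z.
  move=> KZ; have := vmin (realify Z).
  by rewrite -!sqr_frobenius_complexify /= realifyK; apply.
have KZ : half_space_meet hs ((2^-1)%:C *: (Y + X)).
  move=> a B hB; have := KY _ _ hB; have := Kv _ _ hB.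
  rewrite -scalemxAl mxtraceZ mulmxDl mxtraceD.
  by case: (\tr _) => x x'; case: (\tr _) => y y'; simpc => /=; lra.
apply/eqP; rewrite -subr_eq0; apply/eqP/sqr_frobenius_le0.
by have := sqr_frobenius_parallelogram Y X; have := Xmin _ KZ; lra.
Qed.

(** Conjugation by [G] is an isometry of a [G]-stable convex set, so it fixes
    the unique point of least norm. *)
Lemma conjugation_fixed_point (R : realType) n (GG : set 'M[R[i]]_n)
    (hs : R -> 'M[R[i]]_n -> Prop) :
  (forall G, GG G -> G \is unitarymx) ->
  (forall G a B, GG G -> hs a B -> hs a (G^t* *m B *m G)) ->
  half_space_meet hs !=set0 ->
  exists2 X, half_space_meet hs X & forall G, GG G -> G *m X = X *m G.
Proof.
move=> uGG hsJ /unique_least_sqr_frobenius[X KX Xuniq]; exists X => // G GG_G.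
have uG := uGG _ GG_G.
rewrite -{2}(Xuniq (G *m X *m G^t* )) ?sqr_frobenius_unitary_conj ?mulmxKtV //.
move=> a B hB; have := KX _ _ (hsJ _ _ _ GG_G hB).
by rewrite !mulmxA mxtrace_mulC !mulmxA.
Qed.

(** * Schur's lemma *)

(** An eigenspace of a matrix commuting with the group is invariant; either it
    is proper, or the matrix is scalar. *)
Lemma commutant_scalar_or_reducible (R : realType) n (GG : set 'M[R[i]]_n) X :
  (0 < n)%N -> (forall G, GG G -> G *m X = X *m G) ->
  reducible GG \/ exists l, X = l%:M.
Proof.
move=> n0 XC.
(* [eigenvalueP] yields row eigenvectors, whence the transpose. *)
have [l /eigenvalueP[w wX w0]] := @eigenvalue_closed R[i] n X^T n0.
pose f : 'cV[R[i]]_n -> 'cV[R[i]]_n := mulmx (X - l%:M).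
pose V := lker (linfun f).
have inV v : (v \in V) = (X *m v == l *: v).
  by rewrite memv_ker lfunE /= /f mulmxBl mul_scalar_mx subr_eq0.
have [VT|VT] := eqVneq V fullv; [right|left].
  exists l; apply/matrixP => i j.
  have : delta_mx j 0 \in V by rewrite VT memvf.
  rewrite inV -colE => /eqP/matrixP/(_ i 0); rewrite !mxE eqxx andbT => ->.
  by rewrite mulr_natr.
exists V; split=> // [|G GG_G v].
  apply/eqP => V0; move: w0; rewrite -trmx_eq0; apply/negP; rewrite negbK.
  by rewrite -memv0 -V0 inV -[X]trmxK -trmx_mul wX linearZ.
rewrite !inV => /eqP Xv.
by rewrite mulmxA -XC // -mulmxA Xv scalemxAr.
Qed.

(** * Rank-one matrices and the inner product *)

Lemma innerE (R : realType) n (u v : 'cV[R[i]]_n) :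
  inner u v = (v^t* *m u) 0 0.
Proof.
rewrite /inner dotmxE trmxK !mxE; apply: eq_bigr => i _.
by rewrite !mxE mulrC.
Qed.

Lemma inner_conj (R : realType) n (u v : 'cV[R[i]]_n) :
  inner v u = (inner u v)^*%R.
Proof.
rewrite !innerE !mxE rmorph_sum; apply: eq_bigr => k _.
by rewrite !mxE rmorphM /= conjCK mulrC.
Qed.

Lemma mxtrace_mul_rank_one (R : realType) n (X : 'M[R[i]]_n)
    (v : 'cV[R[i]]_n) :
  \tr (X *m (v *m v^t* )) = inner (X *m v) v.
Proof. by rewrite mulmxA mxtrace_mulC mulmxA trace_mx11 innerE mulmxA. Qed.

Lemma mxtrace_rank_one_rank_one (R : realType) n (u v : 'cV[R[i]]_n) :
  \tr (u *m u^t* *m (v *m v^t* )) = `|inner v u| ^+ 2.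
Proof.
rewrite mxtrace_mul_rank_one innerE !mulmxA -mulmxA mxE big_ord1 -!innerE.
by rewrite normCK -inner_conj mulrC.
Qed.

(** * Reducibility *)

Theorem theorem7p5 (R : realType) (n : nat) (eps : R) :
  0 < eps -> (2 <= n)%N -> eps < 1 / (3600 * n%:R ^+ 11) ->
  forall GG : set 'M[R[i]]_n,
    unitary_group GG -> compact_mx GG ->
    (exists xi : 'cV[R[i]]_n, weak_approx_fixed_point eps GG xi) ->
    reducible GG.
Proof.
move=> eps0 n2 epsn GG uGG _ [xi [xi1 approx]].
have uG G (GG_G : GG G) : G \is unitarymx by exact: unitary_group_unitary GG_G.
have n0 : (0 < n)%N := ltnW n2.
(* This gives [(1 - eps) ^+ 2 > 9 / 16 > 1 / n]. *)
have eps1 : eps < 1 / 4.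
  apply: lt_le_trans epsn _; rewrite !div1r lef_pV2 ?posrE //; last first.
    by rewrite mulr_gt0 ?exprn_gt0 ?ltr0n.
  have : 1 <= n%:R ^+ 11 :> R by rewrite exprn_ege1 // ler1n.
  lra.
have xi11 : inner xi xi = 1.
  by rewrite -[inner xi xi]sqrtCK -/(euclidean_norm xi) xi1 expr1n.
pose hs a B := (a = -1 /\ B = - 1%:M) \/
  (a = (1 - eps) ^+ 2 /\ exists2 H, GG H & B = H *m xi *m (H *m xi)^t* ).
have hsJ G a B : GG G -> hs a B -> hs a (G^t* *m B *m G).
  move=> GG_G; rewrite -(invmx_unitary (uG _ GG_G)).
  move=> [[-> ->]|[-> [H GG_H ->]]]; [left|right]; split=> //.
    by rewrite mulmxN mulNmx mulmx1 mulVmx // unitarymx_unit // uG.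
  exists (invmx G *m H).
    by apply: (unitary_groupM uGG) => //; exact: (unitary_groupV uGG).
  rewrite (invmx_unitary (uG _ GG_G)) -[RHS]mulmxA !trmx_mul !map_mxM /= trmxCK.
  by rewrite !mulmxA.
have KP : half_space_meet hs (xi *m xi^t* ).
  move=> a B [[-> ->]|[-> [H GG_H ->]]].
    rewrite mulmxN mulmx1 raddfN /= -[xi *m _]mul1mx.
    by rewrite mxtrace_mul_rank_one mul1mx xi11.
  have := approx H GG_H.
  rewrite mxtrace_rank_one_rank_one normc_def lecR.
  by rewrite -rmorphXn /= => ?; rewrite ler_pXn2r ?nnegrE ?sqrtr_ge0 //; lra.
have [X KX XC] := conjugation_fixed_point uG hsJ (ex_intro _ _ KP).
have [//|[l Xl]] := commutant_scalar_or_reducible n0 XC.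
have l1 : n%:R * complex.Re l <= 1.
  have := KX _ _ (or_introl (conj erefl erefl)).
  rewrite Xl mulmxN mulmx1 raddfN /= mxtrace_scalar.
  by rewrite (raddfMNn (@complex.Re R : Rcomplex R -> R)) lerN2 mulr_natl.
have l2 : (1 - eps) ^+ 2 <= complex.Re l.
  have GG1 := unitary_group1 uGG.
  have := KX _ _ (or_intror (conj erefl (ex_intro2 _ _ _ GG1 erefl))).
  rewrite mul1mx Xl mul_scalar_mx mxtraceZ -[xi *m _]mul1mx.
  by rewrite mxtrace_mul_rank_one mul1mx xi11 mulr1.
have : 2 <= n%:R :> R by rewrite ler_nat.
nra.
Qed.
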